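(* Let $\mathcal{P}=\langle X\mid R\rangle$ and $\mathcal{P}'=\langle X'\mid R'\rangle$ be monoid presentations such that $\mathcal{P}'$ is obtained from $\mathcal{P}$ by a finite sequence of Tietze transformations, each of which is either of type 3 or 4 and of bounded length, or an arbitrary transformation of type 1 or 2 (in particular, let $\mathcal{P}$ and $\mathcal{P}'$ be finitely generated presentations for the same monoid). 1. Let $A\subset\mathcal{M}(X)$ and let $A'\subset\mathcal{M}(X')$ be the set corresponding to $A$ in $\mathcal{P}'$. Then the distortion function $\mathsf{Dist}_A$ of $\mathcal{P}$ relative to $A$ and the distortion function $\mathsf{Dist}'_{A'}$ of $\mathcal{P}'$ relative to $A'$ are equivalent. 2. If $X$ and $X'$ are finite and $\Gamma$ and $\Gamma'$ are the conjugacy functions relative to $\mathcal{P}$ and $\mathcal{P}'$ respectively, then $\Gamma$ and $\Gamma'$ are strongly equivalent.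
   Context: $\mathcal{M}(X)$ is the free monoid on $X$. $\langle X\mid R\rangle$, $R\subset\mathcal{M}(X)^2$, presents $M=\mathcal{M}(X)/\langle R\rangle$, $\langle R\rangle$ being the congruence generated by $R$. Sets of defining relations are taken symmetric (closed under swapping pairs). Distortion: for $A\subset\mathcal{M}(X)$ and $t$ in the submonoid of $M$ generated by $A$, $\mathsf{length}_A(t)$ is the least $m$ such that $t=a_1\cdots a_m$ in $M$ with $a_i\in A$; $\mathsf{Dist}_A(n)$ is the maximum (supremum) of $\mathsf{length}_A(t)$ over words $t\in\mathcal{M}(X)$ with $|t|\le n$ representing elements of that submonoid. Conjugacy function: $a_1$ is conjugated to $a_2$ in $M$ if $ta_1=a_2t$ for some $t\in M$; then $\gamma(a_1,a_2)=\min\{|t|:t\in\mathcal{M}(X),ta_1=a_2t\text{ in }M\}$, and for $X$ finite $\Gamma(n_1,n_2)=\max\{\gamma(a_1,a_2):a_1,a_2\in\mathcal{M}(X),\ a_1\text{ conjugated to }a_2\text{ in }M,\ |a_1|\le n_1,|a_2|\le n_2\}$. Tietze transformations of $\langle X\mid R\rangle$: Type 1: for $Q\subset\langle R\rangle$, replace $R$ by $R\cup Q$. Type 2: for $Q\subset R$ with $\langle R\setminus Q\rangle=\langle R\rangle$, replace $R$ by $R\setminus Q$. Type 3: for $U\subset\mathcal{M}(X)$ take pairwise distinct new letters $y_u$ ($u\in U$), and replace $X$ by $X\cup\{y_u:u\in U\}$ and $R$ by $R\cup\{(y_u,u):u\in U\}$; it is of bounded length if $\sup\{|u|:u\in U\}<\infty$.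 Type 4: let $Y\subset X$ be such that for every $y\in Y$ there is a word $u_y$ on $X\setminus Y$ with $(y,u_y)\in R$; let $T=\{(y,u_y):y\in Y\}$ and let $\varphi:\mathcal{M}(X)\to\mathcal{M}(X\setminus Y)$ be the homomorphism with $y\mapsto u_y$ for $y\in Y$ and $x\mapsto x$ for $x\in X\setminus Y$; replace $X$ by $X\setminus Y$ and $R$ by $\{(\varphi(a),\varphi(b)):(a,b)\in R\setminus T\}$; it is of bounded length if $\sup\{|u_y|:y\in Y\}<\infty$. The set corresponding to $A$ by a single transformation is $A$ for types 1, 2, 3 and $\varphi(A)$ for type 4; for a sequence of transformations one applies this successively. For functions $f,g$ of $p$ non-negative real variables with non-negative values (functions on tuples of natural numbers being extended by taking integer parts of the arguments): $f\preceq g$ ($f,g$ non-decreasing) means there is $\alpha>0$ with $f(x_1,\dots,x_p)\le\alpha g(\alpha x_1,\dots,\alpha x_p)+\alpha(x_1+\cdots+x_p)$ for all non-zero naturals $x_i$; $f,g$ are equivalent if $f\preceq g$ and $g\preceq f$. They are strongly equivalent if there is $\alpha>0$ with $f(x_1,\dots,x_p)\le\alpha g(x_1,\dots,x_p)$ and $g(x_1,\dots,x_p)\le\alpha f(x_1,\dots,x_p)$ for all non-zero naturals $x_i$.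
   Formalization: Strong equivalence in part 2 is taken with rescaled arguments, Γ(n1,n2) ≤ αΓ'(αn1,αn2) and conversely; the unscaled version fails: adjoining c=ab, d=ba to the free monoid on a,b gives Γ(1,1)=0 but Γ'(1,1)≥1. *)

(* Defs.v *)
From HB Require Import structures.
From mathcomp Require Import all_boot all_order all_algebra.
From mathcomp Require Import boolp classical_sets functions cardinality reals ereal.

Set Implicit Arguments.
Unset Strict Implicit.
Unset Printing Implicit Defensive.

Import Order.TTheory GRing.Theory Num.Theory.

Local Open Scope classical_set_scope.
Local Open Scope nat_scope.

(* Letters are elements of an ambient type T, and the free monoid M(X) on a set
   X of letters is the set of sequences (words) over T all of whose letters lie
   in X. Words on different alphabets thus live in the same type, as is needed
   to add and remove letters along Tietze transformations. *)
Definition words (T : Type) (X : set T) : set (seq T) :=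
  [set w | all (fun x => x \in X) w].

Record presentation (T : Type) := Presentation {
  gens : set T;
  rels : set (seq T * seq T);
  rels_words : forall a b, rels (a, b) -> words gens a /\ words gens b;
  rels_sym : forall a b, rels (a, b) -> rels (b, a)
}.

Inductive congr_gen (T : Type) (X : set T) (R : set (seq T * seq T)) :
    seq T -> seq T -> Prop :=
| CongrRel a b : R (a, b) -> congr_gen X R a b
| CongrRefl a : words X a -> congr_gen X R a a
| CongrSym a b : congr_gen X R a b -> congr_gen X R b a
| CongrTrans a b c :
    congr_gen X R a b -> congr_gen X R b c -> congr_gen X R a c
| CongrMul a b c d : congr_gen X R a b -> congr_gen X R c d ->
    congr_gen X R (a ++ c) (b ++ d).

(* The congruence generated by R, as a set of pairs. *)
Definition congr_set (T : Type) (X : set T) (R : set (seq T * seq T)) :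
    set (seq T * seq T) :=
  [set p | congr_gen X R p.1 p.2].

(* "a = b in M", where M is the monoid presented by P. *)
Definition eqM (T : Type) (P : presentation T) (a b : seq T) : Prop :=
  congr_gen (gens P) (rels P) a b.

Definition fin_gen (T : Type) (P : presentation T) : Prop :=
  finite_set (gens P).

(* The monoids presented by P and P' are isomorphic; h is given on
   representatives. *)
Definition same_monoid (T : Type) (P P' : presentation T) : Prop :=
  exists h : seq T -> seq T,
    [/\ forall a, words (gens P) a -> words (gens P') (h a),
        eqM P' (h [::]) [::],
        forall a b, words (gens P) a -> words (gens P) b ->
          eqM P' (h (a ++ b)) (h a ++ h b),
        forall a b, words (gens P) a -> words (gens P) b ->
          (eqM P a b <-> eqM P' (h a) (h b))
      & forall b, words (gens P') b ->
          exists2 a, words (gens P) a & eqM P' (h a) b].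

Definition bounded_length (T : Type) (U : set (seq T)) : Prop :=
  exists N, forall u, U u -> size u <= N.

Definition tietze1 (T : Type) (P P' : presentation T) : Prop :=
  exists Q : set (seq T * seq T),
    [/\ Q `<=` congr_set (gens P) (rels P),
        gens P' = gens P
      & rels P' = rels P `|` Q].

Definition tietze2 (T : Type) (P P' : presentation T) : Prop :=
  exists Q : set (seq T * seq T),
    [/\ Q `<=` rels P,
        congr_set (gens P) (rels P `\` Q) = congr_set (gens P) (rels P),
        gens P' = gens P
      & rels P' = rels P `\` Q].

(* The pairs (u, y_u) are added along with the pairs (y_u, u) because sets of
   defining relations are symmetric. *)
Definition tietze3 (T : Type) (U : set (seq T)) (y : seq T -> T)
    (P P' : presentation T) : Prop :=
  [/\ U `<=` words (gens P),
      forall u, U u -> ~ gens P (y u),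
      forall u v, U u -> U v -> y u = y v -> u = v,
      gens P' = gens P `|` [set y u | u in U]
    & rels P' = rels P `|` [set ([:: y u], u) | u in U]
                       `|` [set (u, [:: y u]) | u in U]].

(* The homomorphism phi with y |-> u y for y in Y, fixing the other letters. *)
Definition elim_letters (T : Type) (Y : set T) (u : T -> seq T) (w : seq T) :
    seq T :=
  flatten [seq if x \in Y then u x else [:: x] | x <- w].

(* The image of the symmetric set rels P minus T is again symmetric: a pair of T
   and the swapped pair have the same trivial image (u y, u y). *)
Definition tietze4 (T : Type) (Y : set T) (u : T -> seq T)
    (P P' : presentation T) : Prop :=
  [/\ Y `<=` gens P,
      forall y, Y y ->
        words (gens P `\` Y) (u y) /\ rels P ([:: y], u y),
      gens P' = gens P `\` Y
    & rels P' = [set (elim_letters Y u p.1, elim_letters Y u p.2)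
                  | p in rels P `\` [set ([:: y], u y) | y in Y]]].

(* The last argument is the map A |-> A' on words: the set corresponding to A
   by the transformation is the image of A under it. *)
Inductive bounded_step (T : Type) (P P' : presentation T) :
    (seq T -> seq T) -> Prop :=
| Step1 : tietze1 P P' -> bounded_step P P' id
| Step2 : tietze2 P P' -> bounded_step P P' id
| Step3 U y : bounded_length U -> tietze3 U y P P' -> bounded_step P P' id
| Step4 Y u : bounded_length [set u y | y in Y] -> tietze4 Y u P P' ->
    bounded_step P P' (elim_letters Y u).

Inductive bounded_tietze (T : Type) :
    presentation T -> presentation T -> (seq T -> seq T) -> Prop :=
| TietzeNil P : bounded_tietze P P id
| TietzeCons P P' P'' f g : bounded_step P P' f -> bounded_tietze P' P'' g ->
    bounded_tietze P P'' (g \o f).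

Definition is_least (S : set nat) (m : nat) : Prop :=
  S m /\ forall k, S k -> m <= k.

Definition has_factorization (T : Type) (P : presentation T)
    (A : set (seq T)) (t : seq T) (m : nat) : Prop :=
  exists s : seq (seq T),
    [/\ size s = m, all (fun a => a \in A) s & eqM P t (flatten s)].

Definition length_is (T : Type) (P : presentation T) (A : set (seq T))
    (t : seq T) (m : nat) : Prop :=
  is_least [set k | has_factorization P A t k] m.

(* Words outside the submonoid generated by A have no length and so do not
   contribute. The value is +oo when the lengths are unbounded, which can happen
   when there are infinitely many generators. *)
Definition Dist (R : realType) (T : Type) (P : presentation T)
    (A : set (seq T)) (n : nat) : \bar R :=
  ereal_sup [set (m%:R)%:E | m in [set m : nat | exists t,
    [/\ words (gens P) t, size t <= n & length_is P A t m]]].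

Definition conj_by (T : Type) (P : presentation T) (a1 a2 t : seq T) : Prop :=
  words (gens P) t /\ eqM P (t ++ a1) (a2 ++ t).

Definition gamma_is (T : Type) (P : presentation T) (a1 a2 : seq T)
    (m : nat) : Prop :=
  is_least [set size t | t in conj_by P a1 a2] m.

(* Pairs that are not conjugated have no gamma and so do not contribute; with
   finitely many generators the supremum is over a finite set. *)
Definition Gamma (R : realType) (T : Type) (P : presentation T)
    (n1 n2 : nat) : \bar R :=
  ereal_sup [set (m%:R)%:E | m in [set m : nat | exists a1 a2,
    [/\ words (gens P) a1, words (gens P) a2, size a1 <= n1, size a2 <= n2
      & gamma_is P a1 a2 m]]].

Lemma Dist_nondecreasing (R : realType) (T : Type) (P : presentation T)
    (A : set (seq T)) (m n : nat) :
  m <= n -> (Dist R P A m <= Dist R P A n)%E.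
Proof.
move=> mn; apply/ereal_sup_le/image_subset => k [t [wt tm lt]].
by exists t; split=> //; exact: leq_trans mn.
Qed.

Lemma Gamma_nondecreasing (R : realType) (T : Type) (P : presentation T)
    (m1 m2 n1 n2 : nat) :
  m1 <= n1 -> m2 <= n2 -> (Gamma R P m1 m2 <= Gamma R P n1 n2)%E.
Proof.
move=> mn1 mn2; apply/ereal_sup_le/image_subset => k [a1 [a2 [w1 w2 s1 s2 g]]].
by exists a1, a2; split=> //; [exact: leq_trans mn1|exact: leq_trans mn2].
Qed.

(* Extension to real variables by integer parts, for one and two variables. *)
Definition real_ext1 (R : realType) (f : nat -> \bar R) (x : 'I_1 -> R) :
    \bar R :=
  f (Num.truncn (x ord0)).

Definition real_ext2 (R : realType) (f : nat -> nat -> \bar R)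
    (x : 'I_2 -> R) : \bar R :=
  f (Num.truncn (x ord0)) (Num.truncn (x ord_max)).

Local Open Scope ring_scope.
Local Open Scope ereal_scope.

Definition dominated (R : realType) (p : nat) (f g : ('I_p -> R) -> \bar R) :
    Prop :=
  exists2 alpha : R, (0 < alpha)%R &
    forall x : 'I_p -> nat, (forall i, (0 < x i)%N) ->
      f (fun i => (x i)%:R) <=
        alpha%:E * g (fun i => (alpha * (x i)%:R)%R)
        + (alpha * \sum_(i < p) (x i)%:R)%:E.

Definition equivalent (R : realType) (p : nat) (f g : ('I_p -> R) -> \bar R) :
    Prop :=
  dominated f g /\ dominated g f.

(* The arguments are rescaled as in [dominated]; only the linear term is
   dropped. With unscaled arguments on the right-hand sides, the conjugacy
   function would not be invariant: adjoining c = ab and d = ba to the free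
   monoid on a, b turns Gamma(1, 1) = 0 into Gamma(1, 1) = 1, the new letters c
   and d being conjugated by b but distinct. *)
Definition strongly_equivalent (R : realType) (p : nat)
    (f g : ('I_p -> R) -> \bar R) : Prop :=
  exists2 alpha : R, (0 < alpha)%R &
    forall x : 'I_p -> nat, (forall i, (0 < x i)%N) ->
      f (fun i => (x i)%:R) <= alpha%:E * g (fun i => (alpha * (x i)%:R)%R) /\
      g (fun i => (x i)%:R) <= alpha%:E * f (fun i => (alpha * (x i)%:R)%R).

(* Main.v *)
Require Import Defs.
From mathcomp Require Import all_boot all_order all_algebra.
From mathcomp Require Import boolp classical_sets functions cardinality reals ereal.
From Stdlib Require List.

Set Implicit Arguments.
Unset Strict Implicit.
Unset Printing Implicit Defensive.

Import Order.TTheory GRing.Theory Num.Theory.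

Local Open Scope classical_set_scope.

(** Each bounded transformation comes with a homomorphism of free monoids in
    either direction, multiplying lengths by at most a constant, which induce
    mutually inverse isomorphisms of the presented monoids. Such pairs compose,
    and they transport factorizations over A and conjugating words with at most
    linear loss.

    Conversely, let h be an isomorphism between finitely generated presentations
    of the same monoid with disjoint sets of generators X and X'. Adjoin the
    letters of X' along preimages of h (Type 3), pass to the full congruence
    (Type 1), eliminate every x in X along the relation x = h(x) (Type 4) and
    discard the relations outside R' (Type 2). Overlapping alphabets are
    separated by passing through a copy of the second presentation on fresh
    letters. *)

(** * Words, generated congruences and the elimination homomorphism *)

Lemma words_nil (T : Type) (X : set T) : words X [::].
Proof. by []. Qed.

Lemma words_cons (T : Type) (X : set T) x w :
  words X (x :: w) <-> X x /\ words X w.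
Proof.
by rewrite /words /=; split=> [/andP[/set_mem]|[/mem_set-> ->]].
Qed.

Lemma words1 (T : Type) (X : set T) x : words X [:: x] <-> X x.
Proof. by rewrite words_cons; split=> [[]|]. Qed.

Lemma words_cat (T : Type) (X : set T) a b :
  words X (a ++ b) <-> words X a /\ words X b.
Proof. by rewrite /words /= all_cat; split=> [/andP|[-> ->]]. Qed.

Lemma words_sub (T : Type) (X Y : set T) a :
  X `<=` Y -> words X a -> words Y a.
Proof.
by move=> XY; elim: a => // x a IH /words_cons[/XY ? /IH ?]; apply/words_cons.
Qed.

Lemma words_flatten (T : Type) (X : set T) (A : set (seq T)) s :
  A `<=` words X -> all (fun a => a \in A) s -> words X (flatten s).
Proof.
move=> AX; elim: s => // a s IH /= /andP[/set_mem/AX aX /IH sX].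
exact/words_cat.
Qed.

Lemma words_map (T : Type) (X Y : set T) (r : T -> T) w :
  (forall x, X x -> Y (r x)) -> words X w -> words Y (map r w).
Proof.
by move=> XY; elim: w => // x w IH /words_cons[/XY ? /IH ?]; apply/words_cons.
Qed.

Lemma eqM_words (T : Type) (P : presentation T) a b :
  eqM P a b -> words (gens P) a /\ words (gens P) b.
Proof.
elim=> {a b} [a b /rels_words//|//|a b _ []//|a b c _ [? _] _ []//|].
by move=> a b c d _ [? ?] _ [? ?]; split; apply/words_cat.
Qed.

(** Pulling the congruence generated by [Q] back along [f] gives a congruence on the words over [X],
    so it contains the one generated by [S] as soon as it contains [S]. Every homomorphism below is
    checked on defining relations in this way. *)
Lemma congr_gen_hom (T : Type) (X Y : set T) (S Q : set (seq T * seq T))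
    (f : seq T -> seq T) :
  (forall a, words X a -> words Y (f a)) -> {morph f : a b / a ++ b} ->
  (forall a b, S (a, b) -> congr_gen Y Q (f a) (f b)) ->
  forall a b, congr_gen X S a b -> congr_gen Y Q (f a) (f b).
Proof.
move=> fw fM fr a b; elim=> {a b} [a b /fr//|a /fw|a b _|a b c _ h _|].
- exact: CongrRefl.
- exact: CongrSym.
- exact: CongrTrans h.
- by move=> a b c d _ h1 _ h2; rewrite !fM; apply: CongrMul.
Qed.

Section ElimLetters.
Variables (T : Type) (Y : set T) (u : T -> seq T).

Lemma elim_letters_cat : {morph elim_letters Y u : a b / a ++ b}.
Proof. by move=> a b; rewrite /elim_letters map_cat flatten_cat. Qed.

Lemma elim_letters_cons x w :
  elim_letters Y u (x :: w) =
  (if x \in Y then u x else [:: x]) ++ elim_letters Y u w.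
Proof. by []. Qed.

Lemma elim_letters1 y : Y y -> elim_letters Y u [:: y] = u y.
Proof. by move=> Yy; rewrite elim_letters_cons mem_set// cats0. Qed.

Lemma elim_letters_id w : words (~` Y) w -> elim_letters Y u w = w.
Proof.
elim: w => // x w IH /words_cons[nYx /IH wE].
by rewrite elim_letters_cons memNset// wE.
Qed.

Lemma words_elim_letters (X Z : set T) w :
  X `\` Y `<=` Z -> (forall y, X y -> Y y -> words Z (u y)) ->
  words X w -> words Z (elim_letters Y u w).
Proof.
move=> XZ uZ; elim: w => // x w IH /words_cons[Xx /IH wZ].
rewrite elim_letters_cons; apply/words_cat; split=> //.
case: ifPn => [/set_mem/(uZ _ Xx)//|/negP nYx].
by apply/words1/XZ; split=> // /mem_set.
Qed.

(** Letters outside [Y] keep length 1, which [N] has to cover as well; hence its positivity. *)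
Lemma size_elim_letters N w : (0 < N)%N ->
  (forall y, Y y -> (size (u y) <= N)%N) ->
  (size (elim_letters Y u w) <= N * size w)%N.
Proof.
move=> N0 uN; elim: w => // x w IH.
rewrite elim_letters_cons size_cat mulnS leq_add//.
by case: ifPn => [/set_mem/uN|].
Qed.

Lemma congr_gen_elim_letters (X : set T) S w :
  (forall y, X y -> Y y -> congr_gen X S [:: y] (u y)) ->
  words X w -> congr_gen X S (elim_letters Y u w) w.
Proof.
move=> uE; elim: w => [|x w IH /words_cons[Xx /IH wE]]; first by constructor.
rewrite elim_letters_cons -(cat1s x w); apply: CongrMul => //.
by case: ifPn => [/set_mem/(uE _ Xx)/CongrSym//|_]; constructor; apply/words1.
Qed.

End ElimLetters.

(** * Length-bounded isomorphisms and invariance *)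

(** Size and concatenation are controlled on all sequences, so [f] is a genuine homomorphism and not
    just one modulo the relations; the size bound alone forces [f [::] = [::]]. *)
Record bounded_hom (T : Type) (P P' : presentation T) (C : nat)
    (f : seq T -> seq T) : Prop := BoundedHom {
  hom_words : forall a, words (gens P) a -> words (gens P') (f a);
  hom_size : forall a, (size (f a) <= C * size a)%N;
  hom_cat : {morph f : a b / a ++ b};
  hom_eqM : forall a b, eqM P a b -> eqM P' (f a) (f b) }.

(** The two maps are mutually inverse only modulo the relations. A single constant for both
    directions keeps the notion symmetric. *)
Record bounded_iso (T : Type) (P P' : presentation T) (C : nat)
    (f g : seq T -> seq T) : Prop := BoundedIso {
  iso_hom : bounded_hom P P' C f;
  iso_inv_hom : bounded_hom P' P C g;
  iso_K : forall a, words (gens P) a -> eqM P (g (f a)) a;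
  iso_invK : forall b, words (gens P') b -> eqM P' (f (g b)) b }.

Lemma bounded_iso_sym (T : Type) (P P' : presentation T) C f g :
  bounded_iso P P' C f g -> bounded_iso P' P C g f.
Proof. by case. Qed.

Lemma bounded_hom_comp (T : Type) (P P' P'' : presentation T) C D f g :
  bounded_hom P P' C f -> bounded_hom P' P'' D g ->
  bounded_hom P P'' (D * C) (g \o f).
Proof.
case=> fw fs fM fE [gw gs gM gE]; split=> /= [a /fw/gw//|a|a b|a b /fE/gE//].
- by rewrite -mulnA (leq_trans (gs _))// leq_mul2l fs orbT.
- by rewrite /= fM gM.
Qed.

Lemma bounded_iso_comp (T : Type) (P P' P'' : presentation T) C D f g f' g' :
  bounded_iso P P' C f g -> bounded_iso P' P'' D f' g' ->
  bounded_iso P P'' (D * C) (f' \o f) (g \o g').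
Proof.
case=> f1 g1 K1 K1' [f2 g2 K2 K2']; split.
- exact: bounded_hom_comp f2.
- by rewrite mulnC; apply: bounded_hom_comp g1.
- move=> a wa /=; apply: CongrTrans (K1 a wa).
  by apply: (hom_eqM g1); apply: K2; apply: (hom_words f1).
- move=> a wa /=; apply: CongrTrans (K2' a wa).
  by apply: (hom_eqM f2); apply: K1'; apply: (hom_words g2).
Qed.

Lemma bounded_iso_id (T : Type) (P P' : presentation T) :
  gens P' = gens P -> (forall a b, eqM P a b <-> eqM P' a b) ->
  bounded_iso P P' 1 id id.
Proof.
move=> gE PE; split.
- by split=> // [a|a|a b /PE//]; rewrite ?gE ?mul1n.
- by split=> // [a|a|a b /PE//]; rewrite ?gE ?mul1n.
- by move=> a wa; apply: CongrRefl.
- by move=> a wa; apply: CongrRefl.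
Qed.

Lemma iso_eqM (T : Type) (P P' : presentation T) C f g a b :
  bounded_iso P P' C f g -> words (gens P) a -> words (gens P) b ->
  eqM P a b <-> eqM P' (f a) (f b).
Proof.
case=> fh gh K _ wa wb; split; first exact: (hom_eqM fh).
move=> /(hom_eqM gh) gE; apply: CongrTrans (K _ wb).
exact: CongrTrans (CongrSym (K _ wa)) gE.
Qed.

(** * Bounded Tietze transformations as length-bounded isomorphisms *)

Lemma tietze1_iso (T : Type) (P P' : presentation T) :
  tietze1 P P' -> bounded_iso P P' 1 id id.
Proof.
move=> [Q [QP gE rE]]; apply: bounded_iso_id => // a b.
rewrite /eqM gE rE; split; apply: congr_gen_hom => //.
- by move=> {}a {}b ab; apply: CongrRel; left.
- by move=> {}a {}b [ab|/QP//]; apply: CongrRel.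
Qed.

Lemma tietze2_iso (T : Type) (P P' : presentation T) :
  tietze2 P P' -> bounded_iso P P' 1 id id.
Proof.
move=> [Q [_ QE gE rE]]; apply: bounded_iso_id => // a b.
rewrite /eqM gE rE.
by have /seteqP[h1 h2] := QE; split; [apply: (h2 (a, b))|apply: (h1 (a, b))].
Qed.

(** Off the image of [U], the inverse takes default values from [d]. *)
Lemma left_inverse_on (A B : Type) (U : set A) (f : A -> B) (d : B -> A) :
  (forall u v, U u -> U v -> f u = f v -> u = v) ->
  exists g, forall u, U u -> g (f u) = u.
Proof.
move=> fI.
have /choice[g gE] : forall z, exists u, forall v, U v -> f v = z -> u = v.
  move=> z; have [[u Uu fu]|n] := pselect (exists2 u, U u & f u = z).
    by exists u => v Uv fv; apply: fI => //; rewrite fu.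
  by exists (d z) => v Uv fv; case: n; exists v.
by exists g => u Uu; apply: gE.
Qed.

(** Forward the map is the inclusion of words; backward each new letter [y u] is replaced by [u],
    which is recovered from the letter because [y] is injective on [U]. Old letters are fixed since
    the new ones are fresh. *)
Lemma tietze3_iso (T : Type) (U : set (seq T)) y (P P' : presentation T) :
  bounded_length U -> tietze3 U y P P' -> exists C g,
  (0 < C)%N /\ bounded_iso P P' C id g.
Proof.
move=> [N UN] [Uw yN yI gE rE].
have [v vE] := left_inverse_on (fun=> [::]) yI.
pose g := elim_letters [set y u | u in U] v.
have gP : gens P `<=` ~` [set y u | u in U].
  by move=> x Px [u Uu yx]; apply: (yN u) => //; rewrite yx.
have gid a : words (gens P) a -> g a = a.
  by move=> wa; apply: elim_letters_id; apply: words_sub wa.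
have PP' : gens P `<=` gens P' by rewrite gE => x; left.
have relU u : U u -> rels P' ([:: y u], u).
  by move=> Uu; rewrite rE; left; right; exists u.
(* The successor keeps the constant positive when [N] is 0. *)
exists N.+1, g; split=> //; split.
- split=> // [a|a|a b]; [exact: words_sub|exact: leq_pmull|].
  apply: congr_gen_hom => // [{}a|{}a {}b ab]; first exact: words_sub.
  by apply: CongrRel; rewrite rE; left; left.
- have gw a : words (gens P') a -> words (gens P) (g a).
    apply: words_elim_letters; first by rewrite gE => x [[]].
    by move=> _ _ [u Uu <-]; rewrite vE//; apply: Uw.
  split=> //.
  + move=> a; apply: size_elim_letters => // _ [u Uu <-].
    by rewrite vE// leqW// UN.
  + exact: elim_letters_cat.
  + move=> a b; apply: congr_gen_hom => //; first exact: elim_letters_cat.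
    move=> {}a {}b; rewrite rE.
    have gy u : U u -> g [:: y u] = u.
      by move=> Uu; rewrite /g elim_letters1 ?vE//; exists u.
    move=> [[ab|[u Uu [<- <-]]]|[u Uu [<- <-]]].
    * by have [wa wb] := rels_words ab; rewrite !gid//; apply: CongrRel.
    * by rewrite gy// gid; [apply: CongrRefl|]; apply: Uw.
    * by rewrite gy// gid; [apply: CongrRefl|]; apply: Uw.
- by move=> a wa; rewrite gid//; apply: CongrRefl.
- move=> b wb; apply: congr_gen_elim_letters => // _ _ [u Uu <-].
  by rewrite vE//; apply/CongrRel/relU.
Qed.

(** This mirrors Type 3: elimination goes forward, inclusion goes backward, and elimination does not
    change the class of a word in [P]. *)
Lemma tietze4_iso (T : Type) (Y : set T) u (P P' : presentation T) :
  bounded_length [set u y | y in Y] -> tietze4 Y u P P' -> exists C,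
  (0 < C)%N /\ bounded_iso P P' C (elim_letters Y u) id.
Proof.
move=> [N UN] [YP uP gE rE]; exists N.+1; split=> //.
have fid a : words (gens P `\` Y) a -> elim_letters Y u a = a.
  by move=> wa; apply: elim_letters_id; apply: words_sub wa => x [].
have fw a : words (gens P) a -> words (gens P') (elim_letters Y u a).
  apply: words_elim_letters; first by rewrite gE.
  by move=> y _ /uP[]; rewrite gE.
have gw a : words (gens P') a -> words (gens P) a.
  by rewrite gE; apply: words_sub => x [].
have fE a : words (gens P) a -> eqM P (elim_letters Y u a) a.
  apply: congr_gen_elim_letters => y _ /uP[_ ?].
  exact: CongrRel.
split=> //.
- split=> //.
  + by move=> a; apply: size_elim_letters => // y Yy; rewrite leqW// UN//; exists y.
  + exact: elim_letters_cat.
  + move=> a b; apply: congr_gen_hom => //; first exact: elim_letters_cat.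
    move=> {}a {}b ab.
    (* A removed pair becomes trivial, because [u y] contains no letter of [Y]; any other pair
       becomes a defining relation of [P']. *)
    have [[y Yy [<- <-]]|nab] := pselect ([set ([:: y], u y) | y in Y] (a, b)).
      have [uw _] := uP _ Yy.
      by rewrite elim_letters1// fid//; apply: CongrRefl; rewrite gE.
    by apply: CongrRel; rewrite rE; exists (a, b).
- split=> // [a|a b]; first exact: leq_pmull.
  apply: congr_gen_hom => // {}a {}b; rewrite rE => -[[c d] [cd _] /= [<- <-]].
  have [wc wd] := rels_words cd.
  apply: CongrTrans (fE _ wc) _; apply: CongrTrans (CongrSym (fE _ wd)).
  exact: CongrRel.
- by move=> b wb; rewrite fid -?gE//; apply: CongrRefl.
Qed.

Lemma bounded_tietze_iso (T : Type) (P P' : presentation T) f :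
  bounded_tietze P P' f -> exists C g, (0 < C)%N /\ bounded_iso P P' C f g.
Proof.
elim=> {P P' f} [P|P P1 P' f f' st _ [D [g' [D0 i']]]].
  by exists 1%N, id; split=> //; apply: bounded_iso_id.
have [C [g [C0 i]]] : exists C g, (0 < C)%N /\ bounded_iso P P1 C f g.
  case: st => [/tietze1_iso|/tietze2_iso|U y bU|Y u bU].
  - by move=> ?; exists 1%N, id.
  - by move=> ?; exists 1%N, id.
  - exact: tietze3_iso bU.
  - by move=> /(tietze4_iso bU)[C ?]; exists C, id.
exists (D * C)%N, (g \o g'); rewrite muln_gt0 D0; split=> //.
exact: bounded_iso_comp i i'.
Qed.

(** * Transport of factorizations and of conjugating words *)

Lemma hom_nil (T : Type) (P P' : presentation T) C f :
  bounded_hom P P' C f -> f [::] = [::].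
Proof.
move=> fh; apply: size0nil.
by have := hom_size fh [::]; rewrite muln0 leqn0 => /eqP.
Qed.

Lemma hom_flatten (T : Type) (P P' : presentation T) C f s :
  bounded_hom P P' C f -> f (flatten s) = flatten (map f s).
Proof.
move=> fh; elim: s => [|a s IH] /=; first exact: hom_nil fh.
by rewrite (hom_cat fh) IH.
Qed.

Lemma has_factorization_eqM (T : Type) (P : presentation T) A t t' m :
  eqM P t t' -> has_factorization P A t m <-> has_factorization P A t' m.
Proof.
move=> tE; split=> -[s [sm sA sE]]; exists s; split=> //.
- exact: CongrTrans (CongrSym tE) sE.
- exact: CongrTrans tE sE.
Qed.

Lemma all_image_map (T U : Type) (f : T -> U) (A : set T) s :
  all (fun b => b \in [set f a | a in A]) s ->
  exists2 r, s = map f r & all (fun a => a \in A) r.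
Proof.
elim: s => [|b s IH /= /andP[/set_mem[a Aa <-] /IH[r -> rA]]]; first by exists [::].
by exists (a :: r) => //=; rewrite rA mem_set.
Qed.

(** The number of factors is preserved exactly: factors map one by one, and factors in the image of
    [A] lift one by one. Only the length of the word [t] is distorted. *)
Lemma iso_has_factorization (T : Type) (P P' : presentation T) C f g A t m :
  bounded_iso P P' C f g -> A `<=` words (gens P) -> words (gens P) t ->
  has_factorization P A t m <-> has_factorization P' [set f a | a in A] (f t) m.
Proof.
move=> i AP wt; have fh := iso_hom i; split=> [[s [sm sA tE]]|[s' [sm]]].
  exists (map f s); split; first by rewrite size_map.
  - rewrite all_map; apply: sub_all sA => a /set_mem Aa /=.
    by apply: mem_set; exists a.
  - by rewrite -(hom_flatten _ fh); apply: (hom_eqM fh) tE.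
move=> /all_image_map[s sE sA]; subst s'; rewrite -(hom_flatten _ fh) => tE.
exists s; split=> //; first by rewrite -sm size_map.
by apply/(iso_eqM i) => //; apply: words_flatten sA.
Qed.

Section Comparison.
Variables (R : realType) (T : Type).
Local Open Scope ereal_scope.

(** The empty word is a product of 0 factors, so the supremum is never over an empty set. *)
Lemma Dist_ge0 (P : presentation T) A n : 0 <= Dist R P A n.
Proof.
apply: ereal_sup_ubound; exists 0%N => //; exists [::]; split=> //.
by split=> //; exists [::]; split=> //; apply: CongrRefl.
Qed.

Lemma length_is_ext (P P' : presentation T) A A' t t' m :
  (forall k, has_factorization P A t k <-> has_factorization P' A' t' k) ->
  length_is P A t m -> length_is P' A' t' m.
Proof. by move=> E [/E ? tm]; split=> // k /E/tm. Qed.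

Lemma iso_Dist_le (P P' : presentation T) C f g A n :
  bounded_iso P P' C f g -> A `<=` words (gens P) ->
  Dist R P A n <= Dist R P' [set f a | a in A] (C * n).
Proof.
move=> i AP; apply/ereal_sup_le/image_subset => m [t [wt tn tm]].
have fh := iso_hom i; exists (f t); split.
- exact: hom_words fh _ wt.
- by rewrite (leq_trans (hom_size fh t))// leq_mul2l tn orbT.
- by apply: length_is_ext tm => k; apply: iso_has_factorization i _ _.
Qed.

(** Applying the previous lemma to the inverse would yield the set [g (f A)], which agrees with [A]
    only modulo the relations. Instead [t] is pulled back to [g t], and [f (g t) = t] holds in the
    second monoid. *)
Lemma iso_Dist_ge (P P' : presentation T) C f g A n :
  bounded_iso P P' C f g -> A `<=` words (gens P) ->
  Dist R P' [set f a | a in A] n <= Dist R P A (C * n).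
Proof.
move=> i AP; apply/ereal_sup_le/image_subset => m [t [wt tn tm]].
have gh := iso_inv_hom i; have wg := hom_words gh wt; exists (g t); split=> //.
- by rewrite (leq_trans (hom_size gh t))// leq_mul2l tn orbT.
- apply: length_is_ext tm => k.
  rewrite (iso_has_factorization _ i)//; apply: has_factorization_eqM.
  exact/CongrSym/(iso_invK i).
Qed.

Lemma ereal_sup_scale (C : nat) (S : set (\bar R)) x y :
  S y -> x <= C%:R%:E * y -> x <= C%:R%:E * ereal_sup S.
Proof.
move=> Sy /le_trans; apply; apply: lee_wpmul2l; first by rewrite lee_fin.
exact: ereal_sup_ubound.
Qed.

Lemma iso_conj_by (P P' : presentation T) C f g a1 a2 t :
  bounded_iso P P' C f g -> words (gens P) a1 -> words (gens P) a2 ->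
  words (gens P) t -> conj_by P a1 a2 t <-> conj_by P' (f a1) (f a2) (f t).
Proof.
move=> i w1 w2 wt; have fh := iso_hom i; rewrite /conj_by -!(hom_cat fh).
rewrite -(iso_eqM i) ?words_cat//; split=> -[_ E]; split=> //.
exact: hom_words fh _ wt.
Qed.

(** A shortest conjugator of [f a1] and [f a2] is pulled back by [g]. The inner factors [C] come
    from the lengths of [f a1] and [f a2], the outer one from the length of the pulled-back
    conjugator. *)
Lemma iso_Gamma_le (P P' : presentation T) C f g n1 n2 :
  bounded_iso P P' C f g ->
  Gamma R P n1 n2 <= C%:R%:E * Gamma R P' (C * n1) (C * n2).
Proof.
move=> i; have fh := iso_hom i; have gh := iso_inv_hom i.
apply: ge_ereal_sup => _ [m [a1 [a2 [w1 w2 s1 s2 [[t ct tm] mmin]]]] <-].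
have [wt _] := ct.
have ct' : conj_by P' (f a1) (f a2) (f t) by apply/(iso_conj_by i).
(* A shortest conjugator exists because [f t] is a conjugator. *)
have [m' [t' [wt' tE] <-] m'min] : exists2 m', [set size t | t in conj_by P' (f a1) (f a2)] m' &
    forall k, [set size t | t in conj_by P' (f a1) (f a2)] k -> (m' <= k)%N.
  have ex : exists k, `[< [set size t | t in conj_by P' (f a1) (f a2)] k >].
    by exists (size (f t)); apply/asboolP; exists (f t).
  case: (ex_minnP ex) => k /asboolP kS kmin; exists k => // j jS.
  by apply: kmin; apply/asboolP.
(* By minimality of [m], it is enough that [g t'] conjugates [a1] to [a2]; this is tested after
   applying [f], where [f (g t')] equals [t'] in the monoid. *)
have mle : (m <= C * size t')%N.
  apply: leq_trans (hom_size gh t').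
  apply: mmin; exists (g t') => //; apply/(iso_conj_by i) => //.
    exact: hom_words gh _ wt'.
  split; first exact/(hom_words fh)/(hom_words gh).
  have fgE := iso_invK i wt'.
  have [w1' w2'] : words (gens P') (f a1) /\ words (gens P') (f a2).
    by split; apply: hom_words fh _ _.
  apply: CongrTrans (CongrMul fgE (CongrRefl _ w1')) _.
  by apply: CongrTrans tE (CongrMul (CongrRefl _ w2') (CongrSym fgE)).
apply: (@ereal_sup_scale _ _ _ ((size t')%:R)%:E).
  exists (size t') => //; exists (f a1), (f a2); split.
  - exact: hom_words fh _ w1.
  - exact: hom_words fh _ w2.
  - by rewrite (leq_trans (hom_size fh _))// leq_mul2l s1 orbT.
  - by rewrite (leq_trans (hom_size fh _))// leq_mul2l s2 orbT.
  - by split=> //; exists t'.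
by rewrite -EFinM lee_fin -natrM ler_nat.
Qed.

Lemma truncn_natM (C n : nat) : Num.truncn (C%:R * n%:R : R)%R = (C * n)%N.
Proof. by rewrite -natrM natrK. Qed.

(** The witness is [C] itself: as [C] is at least 1 and [G] is nonnegative, the outer factor only
    enlarges the bound, and the linear term is nonnegative. *)
Lemma dominated_real_ext1 (F G : nat -> \bar R) (C : nat) : (0 < C)%N ->
  (forall n, 0 <= G n) -> (forall n, F n <= G (C * n)%N) ->
  dominated (real_ext1 F) (real_ext1 G).
Proof.
move=> C0 G0 FG; exists C%:R%R => [|x x0]; first by rewrite ltr0n.
rewrite /real_ext1 natrK truncn_natM.
apply: le_trans (FG _) _; apply: le_trans (_ : C%:R%:E * G (C * x ord0)%N <= _).
  by rewrite -[leLHS]mul1e; apply: lee_wpmul2r; rewrite ?lee_fin ?ler1n.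
by rewrite leeDl// lee_fin mulr_ge0// sumr_ge0.
Qed.

Lemma bounded_tietze_invariance (P P' : presentation T) f :
  bounded_tietze P P' f ->
  (forall A, A `<=` words (gens P) ->
     equivalent (real_ext1 (Dist R P A))
                (real_ext1 (Dist R P' [set f a | a in A]))) /\
  strongly_equivalent (real_ext2 (Gamma R P)) (real_ext2 (Gamma R P')).
Proof.
move=> /bounded_tietze_iso[C [g [C0 i]]]; split=> [A AP|].
  split; apply: (dominated_real_ext1 C0) => n; try exact: Dist_ge0.
  - exact: iso_Dist_le i AP.
  - exact: iso_Dist_ge i AP.
exists C%:R%R => [|x x0]; first by rewrite ltr0n.
rewrite /real_ext2 !natrK !truncn_natM; split.
- exact: iso_Gamma_le i.
- exact: iso_Gamma_le (bounded_iso_sym i).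
Qed.

End Comparison.

(** * Connecting finitely generated presentations of the same monoid *)

Lemma bounded_tietze_trans (T : Type) (P P' P'' : presentation T) f g :
  bounded_tietze P P' f -> bounded_tietze P' P'' g ->
  bounded_tietze P P'' (g \o f).
Proof.
by elim=> // {}P P1 {}P' {}f f' st _ IH /IH; apply: TietzeCons.
Qed.

Lemma bounded_tietze1 (T : Type) (P P' : presentation T) f :
  bounded_step P P' f -> bounded_tietze P P' f.
Proof. by move=> st; apply: TietzeCons st (TietzeNil _). Qed.

(** [List.In] expresses membership without decidable equality on [T], and lets later proofs add
    letters by induction on a list. *)
Lemma finite_set_list (T : Type) (A : set T) :
  finite_set A -> exists s : seq T, A = [set x | List.In x s].
Proof.
move=> /(@finite_seqP {classic T})[s ->]; exists s.
rewrite predeqE => x; elim: s => //= y s IH.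
rewrite inE; split=> [/orP[/eqP->|/IH]|[->|/IH xs]]; [by left|by right| |].
- by rewrite eqxx.
- by apply/orP; right.
Qed.

Lemma finite_bounded_length (T : Type) (U : set (seq T)) :
  finite_set U -> bounded_length U.
Proof.
move=> /finite_set_list[s ->]; elim: s => [|u s [N sN]]; first by exists 0%N.
exists (maxn (size u) N) => v [->|/sN vN]; first exact: leq_maxl.
exact: leq_trans vN (leq_maxr _ _).
Qed.

Lemma congr_gen_mono (T : Type) (X Y : set T) S Q a b :
  X `<=` Y -> S `<=` Q -> congr_gen X S a b -> congr_gen Y Q a b.
Proof.
move=> XY SQ; apply: congr_gen_hom => // [c|c d /SQ]; first exact: words_sub.
exact: CongrRel.
Qed.

Section AddLetter.
Variables (T : Type) (P : presentation T) (x : T) (u : seq T).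
Hypothesis uP : words (gens P) u.

(** These sets are written as images of the singleton [[set u]] so that they have the shape required
    by [tietze3] with a constant letter map. *)
Let added_gens := gens P `|` [set x | _ in [set u]].
Let added_rels :=
  rels P `|` [set ([:: x], v) | v in [set u]] `|` [set (v, [:: x]) | v in [set u]].

Lemma added_rels_words a b :
  added_rels (a, b) -> words added_gens a /\ words added_gens b.
Proof.
have sub : gens P `<=` added_gens by move=> ?; left.
have wx : words added_gens [:: x] by apply/words1; right; exists u.
have wu := words_sub sub uP.
by move=> [[/rels_words[wa wb]|[_ -> [<- <-]]]|[_ -> [<- <-]]]; split=> //;
  apply: words_sub sub _.
Qed.

Lemma added_rels_sym a b : added_rels (a, b) -> added_rels (b, a).
Proof.
move=> [[/rels_sym ba|[_ -> [<- <-]]]|[_ -> [<- <-]]].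
- by left; left.
- by right; exists u.
- by left; right; exists u.
Qed.

Definition add_letter := Presentation added_rels_words added_rels_sym.

Lemma add_letter_step : ~ gens P x -> bounded_step P add_letter id.
Proof.
move=> nx; apply: (@Step3 _ _ _ [set u] (fun=> x)).
  by exists (size u) => _ ->.
by split=> // [_ ->|_ _ -> ->].
Qed.

End AddLetter.

(* The letters are added one at a time because Type 3 introduces one letter per
   word, while different letters may have the same image under [beta]. *)
Lemma add_letters (T : Type) (P : presentation T) (beta : T -> seq T) s :
  (forall x, List.In x s -> ~ gens P x /\ words (gens P) (beta x)) ->
  exists P1 f, [/\ bounded_tietze P P1 f,
    gens P1 = gens P `|` [set x | List.In x s]
  & rels P1 = rels P `|` [set ([:: x], beta x) | x in [set x | List.In x s]]
                     `|` [set (beta x, [:: x]) | x in [set x | List.In x s]]].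
Proof.
elim: s => [|x s IH] sP.
  exists P, id; split; first exact: TietzeNil.
  - by rewrite -[LHS]setU0; congr setU; rewrite predeqE.
  - have -> : [set x : T | List.In x [::]] = set0 by rewrite predeqE.
    by rewrite !image_set0 !setU0.
have [|P1 [f [fP gE rE]]] := IH; first by move=> y ys; apply: sP; right.
(* The list may repeat a letter; a repeated one has already been adjoined. *)
have [xs|nxs] := pselect (List.In x s).
  exists P1, f; split=> //.
    by rewrite gE; congr setU; rewrite predeqE => y; split=> [|[<-|]//]; right.
  have -> // : [set y | List.In y (x :: s)] = [set y | List.In y s].
  by rewrite predeqE => y; split=> [[<-|]//|]; right.
have [nx wx] : ~ gens P x /\ words (gens P) (beta x) by apply: sP; left.
have wx1 : words (gens P1) (beta x) by apply: words_sub wx; rewrite gE => ?; left.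
have st : bounded_step P1 (add_letter x wx1) id.
  by apply: add_letter_step; rewrite gE => -[].
exists (add_letter x wx1), (id \o f); split.
- exact: bounded_tietze_trans fP (bounded_tietze1 st).
- rewrite /= gE image_set1 predeqE => y; rewrite /setU /=.
  have : [set x] y <-> x = y by split=> ->.
  by tauto.
- have -> : [set y | List.In y (x :: s)] = [set y | List.In y s] `|` [set x].
    by rewrite predeqE => y; split=> [[->|]|[|->]]; [right|left|right|left].
  rewrite /= rE !image_setU !image_set1 predeqE => y; rewrite /setU /=.
  by tauto.
Qed.

Section FullCongruence.
Variables (T : Type) (P : presentation T).

Lemma congr_set_words a b : congr_set (gens P) (rels P) (a, b) ->
  words (gens P) a /\ words (gens P) b.
Proof. exact: eqM_words. Qed.

Lemma congr_set_sym a b : congr_set (gens P) (rels P) (a, b) ->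
  congr_set (gens P) (rels P) (b, a).
Proof. exact: CongrSym. Qed.

(** Type 4 asks that the pairs [([:: y], u y)] be defining relations, not mere consequences; taking
    the whole congruence as relations provides this. *)
Definition full_congruence := Presentation congr_set_words congr_set_sym.

Lemma full_congruence_step : bounded_step P full_congruence id.
Proof.
apply: Step1; exists (congr_set (gens P) (rels P)); split=> //=.
by apply/esym/setUidr => -[a b]; apply: CongrRel.
Qed.

End FullCongruence.

Section EliminateLetters.
Variables (T : Type) (P : presentation T) (Y : set T) (u : T -> seq T).
Hypothesis YP : Y `<=` gens P.
Hypothesis uP :
  forall y, Y y -> words (gens P `\` Y) (u y) /\ rels P ([:: y], u y).

Let elim_rels := [set (elim_letters Y u p.1, elim_letters Y u p.2)
                  | p in rels P `\` [set ([:: y], u y) | y in Y]].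

Lemma elim_rels_words a b : elim_rels (a, b) ->
  words (gens P `\` Y) a /\ words (gens P `\` Y) b.
Proof.
move=> [[c d] [/rels_words[wc wd] _] /= [<- <-]].
by split; apply: words_elim_letters (_ : words (gens P) _) => // y _ /uP[].
Qed.

Lemma elim_rels_sym a b : elim_rels (a, b) -> elim_rels (b, a).
Proof.
move=> ab; have [[c d] [cd _] /= [ca db]] := ab.
(* The swapped pair may be one of those removed. Then both images are [u y], and [(a, b)] is its own
   swap. *)
have [[y Yy [yd uc]]|ndc] := pselect ([set ([:: y], u y) | y in Y] (d, c)).
  have [uw _] := uP Yy.
  suff ba : b = a by rewrite {1}ba -[in X in (_, X)]ba.
  rewrite -ca -db -yd -uc elim_letters1// elim_letters_id//.
  by apply: words_sub uw => ? [].
by exists (d, c) => /=; [split=> //; apply: rels_sym|rewrite ca db].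
Qed.

Definition eliminate := Presentation elim_rels_words elim_rels_sym.

Lemma eliminate_step : bounded_length [set u y | y in Y] ->
  bounded_step P eliminate (elim_letters Y u).
Proof. by move=> bu; apply: Step4. Qed.

End EliminateLetters.

Lemma tietze_of_disjoint (T : Type) (P P' : presentation T) :
  fin_gen P -> fin_gen P' -> gens P `<=` ~` gens P' -> same_monoid P P' ->
  exists f, bounded_tietze P P' f.
Proof.
move=> finP finP' dis [h [hw h0 hM hE hS]].
have dis' : gens P' `<=` ~` gens P by move=> x P'x Px; apply: dis Px P'x.
have [beta betaP] : exists beta : T -> seq T, forall x, gens P' x ->
    words (gens P) (beta x) /\ eqM P' (h (beta x)) [:: x].
  have /choice[b bP] : forall x, exists a, gens P' x ->
      words (gens P) a /\ eqM P' (h a) [:: x]; last by exists b.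
  move=> x; have [P'x|nx] := pselect (gens P' x); last by exists [::].
  by have [a wa aE] := hS _ (iffRL (words1 _ _) P'x); exists a.
(* [h] is multiplicative only modulo the relations of [P']. Its values on letters define the strict
   homomorphism [phi], which agrees with [h] modulo those relations; [psi] is likewise a strict
   right inverse of [h] modulo them. *)
pose alpha x := h [:: x].
pose phi := elim_letters (gens P) alpha.
pose psi := elim_letters (gens P') beta.
have phih a : words (gens P) a -> eqM P' (phi a) (h a).
  elim: a => [|x a IH]; first by move=> _; apply: CongrSym h0.
  move=> /words_cons[Px wa]; have wx : words (gens P) [:: x] by apply/words1.
  rewrite /phi elim_letters_cons mem_set//.
  apply: CongrTrans (CongrSym (hM [:: x] a wx wa)).
  by apply: CongrMul (IH wa); apply: CongrRefl; apply: hw.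
have psiw b : words (gens P') b -> words (gens P) (psi b).
  by apply: words_elim_letters => [x []//|x P'x _]; case: (betaP _ P'x).
have hpsi b : words (gens P') b -> eqM P' (h (psi b)) b.
  elim: b => [|x b IH] //; move=> /words_cons[P'x wb].
  have [wx xE] := betaP _ P'x; rewrite /psi elim_letters_cons mem_set//.
  apply: CongrTrans (hM _ _ wx (psiw _ wb)) _; rewrite -(cat1s x b).
  exact: CongrMul xE (IH wb).
have [s sE] := finite_set_list finP'.
have [|P1 [f1 [st1 gE rE]]] := @add_letters _ P beta s.
  move=> x xs; have P'x : gens P' x by rewrite sE.
  by split; [apply: dis'|case: (betaP _ P'x)].
rewrite -sE in gE rE.
have PP1 a b : eqM P a b -> eqM P1 a b.
  by apply: congr_gen_mono; [rewrite gE => x; left|rewrite rE => x; left; left].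
have psi1 b : words (gens P') b -> eqM P1 (psi b) b.
  move=> wb; apply: congr_gen_elim_letters => [x _ P'x|].
    by apply: CongrRel; rewrite rE; left; right; exists x.
  by apply: words_sub wb; rewrite gE => x; right.
have phiid a : words (gens P') a -> phi a = a.
  by move=> wa; apply: elim_letters_id; apply: words_sub wa.
have alphaw y : gens P y -> words (gens P') (alpha y).
  by move=> Py; apply/hw/words1.
(* Old relations are respected because [phi] agrees with [h], the adjoined ones because [h (beta x)]
   equals [x] in the second monoid. *)
have phiE a b : eqM P1 a b -> eqM P' (phi a) (phi b).
  apply: congr_gen_hom; last 1 first.
  - have xE x : gens P' x -> eqM P' (phi [:: x]) (phi (beta x)).
      move=> P'x; have [wx hx] := betaP _ P'x.
      rewrite (phiid [:: x]); last exact/words1.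
      exact: CongrTrans (CongrSym hx) (CongrSym (phih _ wx)).
    move=> {}a {}b; rewrite rE => -[[ab|[x P'x [<- <-]]]|[x P'x [<- <-]]].
    + have [wa wb] := rels_words ab.
      apply: CongrTrans (phih _ wa) _; apply: CongrTrans (CongrSym (phih _ wb)).
      by apply/(hE _ _ wa wb); apply: CongrRel.
    + exact: xE.
    + exact/CongrSym/xE.
  - move=> {}a; rewrite gE.
    by apply: words_elim_letters => [x [[]]//|y _ /alphaw].
  - exact: elim_letters_cat.
pose P2 := full_congruence P1.
have YP2 : gens P `<=` gens P2 by rewrite /= gE => x; left.
have gE3 : gens P2 `\` gens P = gens P'.
  rewrite /= gE predeqE => x; split=> [[[]//]|P'x].
  by split; [right|apply: dis'].
have uP2 y : gens P y ->
    words (gens P2 `\` gens P) (alpha y) /\ rels P2 ([:: y], alpha y).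
  move=> Py; rewrite gE3; have wy := alphaw _ Py; split=> //.
  (* The chain is [y = psi (alpha y) = alpha y]: the first equality holds already in [P], since [h]
     takes both sides to equal elements, and the second comes from the adjoined relations. *)
  apply: CongrTrans (psi1 _ wy); apply: PP1.
  have wy1 : words (gens P) [:: y] by apply/words1.
  by apply/(hE _ _ wy1 (psiw _ wy)); apply: CongrSym (hpsi _ wy).
pose P3 := eliminate uP2.
(* A relation of [P'] holds in [P1], so it belongs to the full congruence; elimination then leaves
   it unchanged because it involves no letter of [P]. *)
have R'R3 : rels P' `<=` rels P3.
  move=> [a b] ab; have [wa wb] := rels_words ab.
  exists (a, b) => /=; last by rewrite -/phi !phiid.
  split; last first.
    move=> [y Py [ya _]]; move: wa; rewrite -ya => /words1.
    exact: dis.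
  apply: CongrTrans (CongrSym (psi1 _ wa)) _; apply: CongrTrans (psi1 _ wb).
  apply: PP1; apply/hE; [exact: psiw|exact: psiw|].
  apply: CongrTrans (hpsi _ wa) _; apply: CongrTrans (CongrSym (hpsi _ wb)).
  exact: CongrRel.
have st4 : bounded_step P3 P' id.
  (* Discarding everything outside [rels P'] is allowed: each relation of [P3] is the image under
     [phi] of an equality in [P1], so it follows from [rels P'] by [phiE]. *)
  apply: Step2; exists (rels P3 `\` rels P').
  have DE : rels P3 `\` (rels P3 `\` rels P') = rels P'.
    by rewrite setDD; apply: setIidr.
  split; [by move=> ? []| |by rewrite -gE3|by rewrite DE].
  rewrite DE; apply/seteqP; split=> -[a b]; first exact: congr_gen_mono.
  apply: (@congr_gen_hom _ _ _ _ _ id) => // c d [[c' d'] [cd _] /= [<- <-]].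
  by rewrite gE3; apply: phiE.
have st3 : bounded_step P2 P3 phi.
  exact/(eliminate_step YP2)/finite_bounded_length/finite_image.
exists ((id \o (phi \o id)) \o f1); apply: bounded_tietze_trans st1 _.
apply: TietzeCons (full_congruence_step _) _.
by apply: TietzeCons st3 (bounded_tietze1 st4).
Qed.

(** * Composing isomorphisms and separating overlapping alphabets *)

(** The inverse picks a preimage of each word; it is multiplicative modulo the relations because [h]
    reflects equality. *)
Lemma same_monoid_sym (T : Type) (P P' : presentation T) :
  same_monoid P P' -> same_monoid P' P.
Proof.
move=> [h [hw h0 hM hE hS]].
have /choice[g gP] : forall b, exists a, words (gens P') b ->
    words (gens P) a /\ eqM P' (h a) b.
  move=> b; have [wb|nb] := pselect (words (gens P') b); last by exists [::].
  by have [a] := hS _ wb; exists a.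
have gw b : words (gens P') b -> words (gens P) (g b) by move=> /gP[].
have gE b : words (gens P') b -> eqM P' (h (g b)) b by move=> /gP[].
have wc := @words_cat T; exists g; split=> //.
- have w0 := words_nil (gens P'); apply/(hE _ _ (gw _ w0) (words_nil _)).
  exact: CongrTrans (gE _ w0) (CongrSym h0).
- move=> a b wa wb; have wab : words (gens P') (a ++ b) by apply/wc.
  apply/hE; [exact: gw|by apply/wc; split; apply: gw|].
  apply: CongrTrans (gE _ wab) (CongrSym _).
  apply: CongrTrans (hM _ _ (gw _ wa) (gw _ wb)) _.
  by apply: CongrMul; apply: gE.
- move=> a b wa wb; rewrite (hE _ _ (gw _ wa) (gw _ wb)); split=> ab.
    apply: CongrTrans (gE _ wa) _; exact: CongrTrans ab (CongrSym (gE _ wb)).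
  apply: CongrTrans (CongrSym (gE _ wa)) _; exact: CongrTrans ab (gE _ wb).
- move=> a wa; have wha := hw _ wa; exists (h a) => //.
  by apply/(hE _ _ (gw _ wha) wa); apply: gE.
Qed.

Lemma same_monoid_trans (T : Type) (P P' P'' : presentation T) :
  same_monoid P P' -> same_monoid P' P'' -> same_monoid P P''.
Proof.
move=> [h [hw h0 hM hE hS]] [k [kw k0 kM kE kS]].
have w0 := words_nil; exists (k \o h); split=> /= [a /hw/kw//||a b wa wb|a b wa wb|c wc].
- by apply: CongrTrans k0; apply/kE => //; apply: hw.
- have [wha whb] := (hw _ wa, hw _ wb).
  apply: CongrTrans (kM _ _ wha whb); apply/kE; last exact: hM.
    by apply: hw; apply/words_cat.
  exact/words_cat.
- by rewrite (hE _ _ wa wb); apply: kE; apply: hw.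
- have [b wb bE] := kS _ wc; have [a wa aE] := hS _ wb; exists a => //.
  by apply: CongrTrans bE; apply/kE => //; apply: hw.
Qed.

Section Rename.
Variables (T : Type) (P : presentation T) (r : T -> T).

Let renamed_gens := [set r x | x in gens P].
Let renamed_rels := [set (map r p.1, map r p.2) | p in rels P].

Lemma renamed_words a : words (gens P) a -> words renamed_gens (map r a).
Proof. by apply: words_map => x Px; exists x. Qed.

Lemma renamed_rels_words a b :
  renamed_rels (a, b) -> words renamed_gens a /\ words renamed_gens b.
Proof.
by move=> [[c d] /rels_words[wc wd] [<- <-]]; split; apply: renamed_words.
Qed.

Lemma renamed_rels_sym a b : renamed_rels (a, b) -> renamed_rels (b, a).
Proof. by move=> [[c d] /rels_sym dc [<- <-]]; exists (d, c). Qed.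

Definition rename := Presentation renamed_rels_words renamed_rels_sym.

Lemma same_monoid_rename s :
  (forall x, gens P x -> s (r x) = x) -> same_monoid P rename.
Proof.
move=> rK.
have mK a : words (gens P) a -> map s (map r a) = a.
  by elim: a => //= x a IH /words_cons[Px /IH->]; rewrite rK.
have sw b : words renamed_gens b -> words (gens P) (map s b).
  by apply: words_map => _ [x Px <-]; rewrite rK.
exists (map r); split.
- exact: renamed_words.
- exact: CongrRefl.
- move=> a b wa wb; rewrite map_cat; apply: CongrRefl.
  by apply/words_cat; split; apply: renamed_words.
- move=> a b wa wb; split.
    apply: congr_gen_hom => [|c d|c d cd]; [exact: renamed_words|exact: map_cat|].
    by apply: CongrRel; exists (c, d).
  (* Conversely, an equality between renamed words is carried back by [map s], which undoes [map r]
     on words over [gens P]. *)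
  rewrite -{2}(mK a wa) -{2}(mK b wb).
  apply: congr_gen_hom => [|c d|_ _ [[c d] cd [<- <-]]].
  + exact: sw.
  + exact: map_cat.
  + by have [wc wd] := rels_words cd; rewrite /= !mK//; apply: CongrRel.
- move=> b wb; exists (map s b); first exact: sw.
  have -> : map r (map s b) = b; last exact: CongrRefl.
  elim: b wb => //= _ b IH /words_cons[[x Px <-] /IH->].
  by rewrite rK.
Qed.

End Rename.

(** The complement of a finite set in an infinite type is infinite, so the countable set [X] injects
    into it; [s] inverts this injection on [X]. *)
Lemma fresh_injection (T : Type) (X F : set T) :
  infinite_set [set: T] -> finite_set X -> finite_set F ->
  exists r s : T -> T, forall x, X x -> ~ F (r x) /\ s (r x) = x.
Proof.
move=> infT finX finF.
have infF : infinite_set (~` F) by rewrite -setTD; apply: infinite_setD.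
have /card_leP[i] : (X #<= ~` F)%card.
  exact: card_le_trans (finite_set_countable finX) (iffLR (infiniteP _) infF).
(* Outside [X] the value is a default. *)
pose r x := if pselect (X x) is left Xx
            then val (i (exist _ x (mem_set Xx) : set_type X)) else x.
have rI u v : X u -> X v -> r u = r v -> u = v.
  move=> Xu Xv; rewrite /r; case: pselect => // Xu'; case: pselect => // Xv'.
  by move=> /val_inj /(inj (mem_set I) (mem_set I))[].
have [s sE] := left_inverse_on id rI.
exists r, s => x Xx; split; last exact: sE.
by rewrite /r; case: pselect => // Xx'; case: (i _) => y /= /set_mem.
Qed.

Lemma tietze_of_same_monoid (T : Type) (P P' : presentation T) :
  infinite_set [set: T] -> fin_gen P -> fin_gen P' -> same_monoid P P' ->
  exists f, bounded_tietze P P' f.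
Proof.
move=> infT finP finP' PP'.
(* The copy must avoid both alphabets, as it is connected to [P] on one side and to [P'] on the
   other, each time through the disjoint case. *)
have finU : finite_set (gens P `|` gens P') by rewrite finite_setU.
have [r [s rs]] := fresh_injection infT finP' finU.
have P'Q : same_monoid P' (rename P' r).
  by apply: (@same_monoid_rename _ _ _ s) => x /rs[].
have finQ : fin_gen (rename P' r) by apply: finite_image.
have [|f fP] := tietze_of_disjoint finP finQ _ (same_monoid_trans PP' P'Q).
  by move=> y Px [x P'x xE]; case: (rs _ P'x) => + _; apply; left; rewrite xE.
have [|g gP] := tietze_of_disjoint finQ finP' _ (same_monoid_sym P'Q).
  by move=> _ [x /rs[nx _] <-] P'x; apply: nx; right.
by exists (g \o f); apply: bounded_tietze_trans gP.
Qed.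

Theorem proposition9p10 (R : realType) (T : Type) (P P' : presentation T) :
  (forall f : seq T -> seq T, bounded_tietze P P' f ->
     (forall A : set (seq T), A `<=` words (gens P) ->
        equivalent (real_ext1 (Dist R P A))
                   (real_ext1 (Dist R P' [set f a | a in A])))
     /\ (fin_gen P -> fin_gen P' ->
         strongly_equivalent (real_ext2 (Gamma R P))
                             (real_ext2 (Gamma R P'))))
  /\ (infinite_set [set: T] -> fin_gen P -> fin_gen P' -> same_monoid P P' ->
      exists f : seq T -> seq T, bounded_tietze P P' f).
Proof.
split=> [f /(bounded_tietze_invariance R)[DE GE]|].
  by split=> // _ _; exact: GE.
exact: tietze_of_same_monoid.
Qed.
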